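(* Let $\mathbb{X},\mathbb{Y}$ be finite dimensional real Hilbert spaces, let $F:\mathbb{X}\times\mathbb{Y}\to\mathbb{R}\cup\{\infty\}$ be a proper closed function, and define $f(x):=\inf_{y\in\mathbb{Y}}F(x,y)$ and $Y(x):=\operatorname{Arg\,min}_{y\in\mathbb{Y}}F(x,y)$ for $x\in\mathbb{X}$. Suppose that $F$ is level-bounded in $y$ locally uniformly in $x$. Let $\alpha\in[0,1)$ and $\bar x\in\operatorname{dom}\partial f$. Suppose in addition that: (i) $\partial F(\bar x,\bar y)\neq\emptyset$ for all $\bar y\in Y(\bar x)$; (ii) $F$ satisfies the KL property with exponent $\alpha$ at every point of $\{\bar x\}\times Y(\bar x)$. Then $f$ satisfies the KL property at $\bar x$ with exponent $\alpha$.
   Context: A function $h:\mathbb{X}\to\mathbb{R}\cup\{\infty\}$ is proper if $\operatorname{dom}h:=\{x:h(x)<\infty\}\neq\emptyset$, and closed if it is lower semicontinuous. The regular subdifferential of a proper $h$ at $x\in\operatorname{dom}h$ is $\hat\partial h(x)=\{\zeta:\liminf_{z\to x,z\ne x}\frac{h(z)-h(x)-\langle\zeta,z-x\rangle}{\|z-x\|}\ge0\}$; the (limiting) subdifferential is $\partial h(x)=\{\zeta:\exists\,x^k\to x,\ h(x^k)\to h(x),\ \zeta^k\to\zeta,\ \zeta^k\in\hat\partial h(x^k)\}$; both are empty for $x\notin\operatorname{dom}h$, and $\operatorname{dom}\partial h:=\{x:\partial h(x)\ne\emptyset\}$. Write $\operatorname{dist}(x,D):=\inf_{y\in D}\|x-y\|$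 (with value $\infty$ if $D=\emptyset$). A proper closed $h$ satisfies the Kurdyka-Łojasiewicz (KL) property at $\hat x\in\operatorname{dom}\partial h$ with exponent $\alpha\in[0,1)$ if there exist $a\in(0,\infty]$, a neighborhood $V$ of $\hat x$ and $\bar c>0$ such that, with $\varphi(s)=\bar c s^{1-\alpha}$, $\varphi'(h(x)-h(\hat x))\operatorname{dist}(0,\partial h(x))\ge1$ for every $x\in V$ with $h(\hat x)<h(x)<h(\hat x)+a$. $F$ is level-bounded in $y$ locally uniformly in $x$ if for each $\bar x\in\mathbb{X}$ and $\beta\in\mathbb{R}$ there is a neighborhood $V$ of $\bar x$ such that $\{(x,y):x\in V,\ F(x,y)\le\beta\}$ is bounded. (Under this assumption $f$ is proper and closed.) *)

(* Defs.v *)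
From HB Require Import structures.
From mathcomp Require Import all_boot all_order all_algebra.
From mathcomp Require Import all_classical all_reals all_analysis.
From mathcomp Require Import ring lra.

Set Implicit Arguments.
Unset Strict Implicit.
Unset Printing Implicit Defensive.

Import Order.TTheory GRing.Theory Num.Theory.
Import numFieldNormedType.Exports.

Local Open Scope classical_set_scope.
Local Open Scope ring_scope.

(* Finite-dimensional real Hilbert spaces: the norm (hence the topology) of the
   normed module is the one induced by the inner product, so that [dot] is
   positive definite; completeness is automatic in finite dimension. *)
HB.mixin Record NormedVector_isFinHilbert (R : realType) H
    & NormedModule R H & Vector R H := {
  dot : H -> H -> R;
  dotC : forall u v, dot u v = dot v u;
  dotPl : forall a u v w, dot (a *: u + v) w = a * dot u w + dot v w;
  dotvv : forall u, dot u u = `|u| ^+ 2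
}.

#[short(type="finHilbertType")]
HB.structure Definition FinHilbert (R : realType) :=
  {H of NormedModule R H & Vector R H & NormedVector_isFinHilbert R H}.

(* The library norms [X * Y] with the max of the two norms; [hprod X Y] is the
   same vector space with the Hilbert structure
   <(x, y), (x', y')> = <x, x'> + <y, y'>. *)
Definition hprod (X Y : Type) : Type := (X * Y)%type.

Section hprod.
Context {R : realType} {X Y : finHilbertType R}.
Local Notation XY := (hprod X Y).
Implicit Types p q : XY.

HB.instance Definition _ := Vector.copy XY (X * Y)%type.

Definition hprod_norm p : R := Num.sqrt (`|p.1| ^+ 2 + `|p.2| ^+ 2).

Let norm_ge0 p : 0 <= `|p.1| ^+ 2 + `|p.2| ^+ 2.
Proof. by rewrite addr_ge0 ?sqr_ge0. Qed.

Let hprod_normE p : hprod_norm p ^+ 2 = `|p.1| ^+ 2 + `|p.2| ^+ 2.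
Proof. exact: sqr_sqrtr. Qed.

Lemma hprod_ler_normD p q : hprod_norm (p + q) <= hprod_norm p + hprod_norm q.
Proof.
have np : 0 <= hprod_norm p by exact: sqrtr_ge0.
have nq : 0 <= hprod_norm q by exact: sqrtr_ge0.
have Ep := hprod_normE p; have Eq := hprod_normE q.
rewrite -(@ler_pXn2r _ 2) ?nnegrE ?addr_ge0 ?sqrtr_ge0// hprod_normE /=.
have h1 : `|(p + q).1| ^+ 2 <= (`|p.1| + `|q.1|) ^+ 2.
  by rewrite ler_pXn2r ?nnegrE ?addr_ge0 ?normr_ge0 ?ler_normD.
have h2 : `|(p + q).2| ^+ 2 <= (`|p.2| + `|q.2|) ^+ 2.
  by rewrite ler_pXn2r ?nnegrE ?addr_ge0 ?normr_ge0 ?ler_normD.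
apply: (le_trans (lerD h1 h2)).
have CS : `|p.1| * `|q.1| + `|p.2| * `|q.2| <= hprod_norm p * hprod_norm q.
  rewrite -(@ler_pXn2r _ 2) ?nnegrE ?addr_ge0 ?mulr_ge0//.
  rewrite exprMn Ep Eq -subr_ge0.
  rewrite [leRHS](_ : _ = (`|p.1| * `|q.2| - `|p.2| * `|q.1|) ^+ 2).
    exact: sqr_ge0.
  by ring.
lra.
Qed.

Lemma hprod_normrZ (a : R) p : hprod_norm (a *: p) = `|a| * hprod_norm p.
Proof.
rewrite /hprod_norm !normrZ !exprMn -mulrDr sqrtrM ?sqr_ge0//.
by rewrite sqrtr_sqr normr_id.
Qed.

Lemma hprod_normr0_eq0 p : hprod_norm p = 0 -> p = 0.
Proof.
move=> p0; have := hprod_normE p; rewrite p0 expr0n /= => /esym/eqP.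
rewrite paddr_eq0 ?sqr_ge0// !sqrf_eq0 !normr_eq0 => /andP[/eqP p1 /eqP p2].
by move: p1 p2; case: p {p0} => a b /= -> ->.
Qed.

HB.instance Definition _ := Lmodule_isNormed.Build R XY
  hprod_ler_normD hprod_normrZ hprod_normr0_eq0.

Definition hprod_dot p q : R := dot p.1 q.1 + dot p.2 q.2.

Lemma hprod_dotC p q : hprod_dot p q = hprod_dot q p.
Proof. by rewrite /hprod_dot dotC (dotC p.2). Qed.

Lemma hprod_dotPl a p q r :
  hprod_dot (a *: p + q) r = a * hprod_dot p r + hprod_dot q r.
Proof. by rewrite /hprod_dot /= !dotPl mulrDr addrACA. Qed.

Lemma hprod_dotvv p : hprod_dot p p = `|p| ^+ 2.
Proof. by rewrite /hprod_dot !dotvv; exact/esym/hprod_normE. Qed.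

HB.instance Definition _ := NormedVector_isFinHilbert.Build R XY
  hprod_dotC hprod_dotPl hprod_dotvv.

End hprod.

Section variational_analysis.
Local Open Scope ereal_scope.
Context {R : realType} {H : finHilbertType R}.
Implicit Types (h : H -> \bar R) (x zeta : H) (D : set H) (alpha : R).

(* Functions into R \cup {oo} are encoded as [H -> \bar R] avoiding -oo. *)
Definition proper_fun h := (forall x, h x != -oo) /\ exists x, h x < +oo.

Definition regular_subdifferential h x : set H :=
  [set zeta | h x < +oo /\
    0 <= limf_einf
      (fun z => (h z - h x - (dot zeta (z - x)%R)%:E) * (`|z - x|^-1)%:E) x^'].

Definition subdifferential h x : set H :=
  [set zeta | h x < +oo /\
    exists u v : nat -> H,
      [/\ u k @[k --> \oo] --> x, h (u k) @[k --> \oo] --> h x,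
          v k @[k --> \oo] --> zeta &
          forall k, regular_subdifferential h (u k) (v k)]].

Definition dom_subdifferential h : set H :=
  [set x | subdifferential h x !=set0].

(* The infimum of the empty set is +oo. *)
Definition dist_set x D : \bar R := ereal_inf [set (`|x - y|)%:E | y in D].

Definition KL_property h alpha x0 :=
  [/\ proper_fun h, lower_semicontinuous h, dom_subdifferential h x0 &
  exists (a : \bar R) (V : set H) (c : R),
    [/\ 0 < a, nbhs x0 V, (0 < c)%R &
     let phi (s : R) : R := (c * s `^ (1 - alpha))%R in
     forall x, V x -> h x0 < h x -> h x < h x0 + a ->
       1 <= (derive1 phi (fine (h x - h x0)))%:E *
            dist_set 0%R (subdifferential h x)]].

End variational_analysis.

Section parametric_minimization.
Local Open Scope ereal_scope.
Context {R : realType} {X Y : finHilbertType R}.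
Implicit Types (F : hprod X Y -> \bar R) (x : X).

Definition inf_projection F x : \bar R :=
  ereal_inf [set F (x, y) | y in [set: Y]].

Definition Argmin F x : set Y :=
  [set y | forall y', F (x, y) <= F (x, y')].

Definition level_bounded_locally_uniformly F :=
  forall (x0 : X) (beta : R), exists2 V : set X, nbhs x0 V &
    bounded_set [set p : hprod X Y | V p.1 /\ F p <= beta%:E].

End parametric_minimization.

(* Main.v *)
(* If [zeta] is a (limiting) subgradient of the inf-projection [f] at [x], then
   [(zeta, 0)] is a subgradient of [F] at [(x, y)] for some [y] in [Argmin F x]:
   for regular subgradients and any minimizer this holds because [F >= f] with
   equality at [(x, y)], and it passes to the limit since level-boundedness
   makes the minimizers accumulate.  If the KL inequality of [f] failed at
   [xbar] with every constant, there would be [x_n --> xbar] with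
   [f (x_n) --> f xbar] from above and subgradients [zeta_n] violating it with
   constant [n + 1].  The corresponding [y_n] accumulate at a minimizer [ybar],
   and the KL inequality of [F] at [(xbar, ybar)], applied to [(zeta_n, 0)],
   which has the same norm as [zeta_n], gives a contradiction for large [n]. *)

Require Import Defs.
From mathcomp Require Import all_boot all_order all_algebra.
From mathcomp Require Import all_classical all_reals all_analysis.
From mathcomp Require Import lra.

Set Implicit Arguments.
Unset Strict Implicit.
Unset Printing Implicit Defensive.

Import Order.TTheory GRing.Theory Num.Theory.
Import numFieldNormedType.Exports.

Local Open Scope classical_set_scope.
Local Open Scope ring_scope.

(** * Compactness and convergent subsequences in finite dimension *)

Section finite_dimension.
Context {R : realType} {H : finHilbertType R}.

(** A basis gives a continuous linear bijection [L] from row vectors onto [H]. Its inverse is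
    bounded, so the ball is a closed subset of the image under [L] of a compact ball of row
    vectors. *)
Lemma closed_ball_norm_compact (M : R) : compact [set v : H | `|v| <= M].
Proof.
pose n := \dim {:H}; pose b := vbasis {:H}.
pose L (u : 'rV[R]_n) : H := \sum_(i < n) u 0 i *: b`_i.
have LE v : L (\row_i coord b i v) = v.
  rewrite [RHS](coord_vbasis (memvf v)); apply: eq_bigr => i _.
  by rewrite mxE.
have LZ a u : L (a *: u) = a *: L u.
  by rewrite scaler_sumr; apply: eq_bigr => i _; rewrite mxE scalerA.
have L0 u : L u = 0 -> u = 0.
  move=> Lu0; apply/rowP => i; rewrite mxE.
  by move/freeP: (basis_free (vbasisP {:H})) => /(_ (fun i => u 0 i) Lu0 i).
have Lcont : continuous L.
  apply: continuous_big => [|i _ u]; first exact: add_continuous.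
  by apply: cvgZr_tmp; [exact: nbhs_filter|exact: coord_continuous].
have bnd (A : set 'rV[R]_n) r : (forall u, A u -> `|u| <= r) -> bounded_set A.
  move=> Ar; exists r; split; first exact: num_real.
  by move=> r' rr' u /Ar ur; exact: le_trans ur (ltW rr').
(* [C] is the inverse of the minimum of [|L u|] on the unit sphere, which is positive because [L] is
   injective; homogeneity extends the bound to all [u]. *)
have [C [C0 CL]] : exists C : R, 0 < C /\ forall u, `|u| <= C * `|L u|.
  have Scpt : compact [set u : 'rV[R]_n | `|u| = 1].
    apply: bounded_closed_compact.
      by apply: (@bnd _ 1) => u /= ->.
    apply: (@closed_comp _ _ (fun u : 'rV[R]_n => `|u|) [set 1]).
      by move=> u _; exact: norm_continuous.
    exact: closed_eq.
  (* In dimension zero the sphere is empty and there is no minimum to take; every [u] is then zero,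
     and any [C] works. *)
  have [S0|/set0P S0] := eqVneq [set u : 'rV[R]_n | `|u| = 1] set0.
    exists 1; split => // u; rewrite mul1r.
    have [->|u0] := eqVneq u 0; first by rewrite normr0.
    have : [set u : 'rV[R]_n | `|u| = 1] (`|u|^-1 *: u).
      by rewrite /= normrZ normfV normr_id mulVf// normr_eq0.
    by rewrite S0.
  have [|c cS cmin] := @compact_EVT_min _ R (fun u => `|L u|) _ S0 Scpt.
    apply: continuous_subspaceT => u.
    by apply: continuous_comp; [exact: Lcont|exact: norm_continuous].
  have Lc0 : 0 < `|L c|.
    rewrite normr_gt0; apply/eqP => /L0 c0.
    by move: cS; rewrite inE /= c0 normr0 => /esym/eqP; rewrite oner_eq0.
  exists `|L c|^-1; split; first by rewrite invr_gt0.
  move=> u; have [->|u0] := eqVneq u 0.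
    by rewrite normr0 mulr_ge0// invr_ge0.
  have nu : 0 < `|u| by rewrite normr_gt0.
  have := cmin (`|u|^-1 *: u); rewrite inE /= LZ !normrZ normfV normr_id.
  rewrite mulVf ?gt_eqF// => /(_ erefl).
  by rewrite ler_pdivlMl// mulrC -ler_pdivlMl.
have cL : compact (L @` [set u | `|u| <= C * M]).
  apply: continuous_compact; first exact: continuous_subspaceT.
  apply: bounded_closed_compact; first exact: (@bnd _ (C * M)).
  apply: (@closed_comp _ _ (fun u : 'rV[R]_n => `|u|) [set x | x <= C * M]); last exact: closed_le.
  by move=> u _; exact: norm_continuous.
apply: (subclosed_compact _ cL) => [|v /= vM].
  apply: (@closed_comp _ _ (fun u : H => `|u|) [set x | x <= M]); last exact: closed_le.
  by move=> u _; exact: norm_continuous.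
exists (\row_i coord b i v); last exact: LE.
by apply: le_trans (CL _) _; rewrite LE ler_pM2l.
Qed.

(** By compactness [v] has a cluster point [l]; [phi k] is an index beyond [k] with [v (phi k)]
    within [1 / (k + 1)] of [l]. Monotonicity of [phi] is not asked for: [k <= phi k] already makes
    [phi] tend to infinity. *)
Lemma bounded_cvg_subseq (v : nat -> H) (M : R) :
  (\forall n \near \oo, `|v n| <= M) ->
  exists (phi : nat -> nat) (l : H),
    (forall k, (k <= phi k)%N) /\ v (phi k) @[k --> \oo] --> l.
Proof.
move=> vM.
have [l [_ lv]] := @closed_ball_norm_compact M (v @ \oo) _ vM.
have ex k : exists m, (k <= m)%N /\ `|l - v m| < k.+1%:R^-1.
  have A : (v @ \oo) (v @` [set m | (k <= m)%N]) by exists k => // m km; exists m.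
  have B : nbhs l (ball l (k.+1%:R^-1 : R)).
    by apply: nbhsx_ballx; rewrite invr_gt0.
  have [_ [[m km <-]]] := lv _ _ A B.
  by rewrite -ball_normE => ?; exists m.
exists (fun k => sval (cid (ex k))), l; split => [k|].
  by case: cid => m [].
apply/cvgrPdist_lt => e e0; near=> k; case: cid => m [_ /=] /lt_trans; apply.
by near: k; exact: near_infty_natSinv_lt (PosNum e0).
Unshelve. all: end_near. Qed.

End finite_dimension.

Lemma cvg_subseq_infty (phi : nat -> nat) :
  (forall k, (k <= phi k)%N) -> phi @ \oo --> \oo.
Proof.
by move=> phik A [N _ NA]; exists N => // k /= Nk; apply/NA/(leq_trans Nk).
Qed.

(** * Norm and convergence in the Hilbert product *)

Section hprod_theory.
Context {R : realType} {X Y : finHilbertType R}.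
Implicit Type p : hprod X Y.

Lemma hprod_sqr_norm p : `|p| ^+ 2 = `|p.1| ^+ 2 + `|p.2| ^+ 2.
Proof. by rewrite sqr_sqrtr// addr_ge0 ?sqr_ge0. Qed.

Lemma le_hprod_norm1 p : `|p.1| <= `|p|.
Proof.
by rewrite -(@ler_pXn2r _ 2) ?nnegrE// hprod_sqr_norm lerDl sqr_ge0.
Qed.

Lemma le_hprod_norm2 p : `|p.2| <= `|p|.
Proof.
by rewrite -(@ler_pXn2r _ 2) ?nnegrE// hprod_sqr_norm lerDr sqr_ge0.
Qed.

Lemma hprod_norm_le p : `|p| <= `|p.1| + `|p.2|.
Proof.
rewrite -(@ler_pXn2r _ 2) ?nnegrE ?addr_ge0// hprod_sqr_norm sqrrD.
by rewrite lerD2r lerDl mulrn_wge0// mulr_ge0.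
Qed.

Lemma hprod_norm_pair0 (x : X) : `|(x, 0) : hprod X Y| = `|x|.
Proof.
apply/eqP; rewrite eq_le (le_hprod_norm1 (x, 0)) andbT.
by apply: le_trans (hprod_norm_le _) _; rewrite normr0 addr0.
Qed.

Lemma cvg_hprod_pair {T : Type} (G : set_system T) {FG : Filter G}
    (f : T -> X) (g : T -> Y) (x : X) (y : Y) :
  f @ G --> x -> g @ G --> y ->
  (fun t => (f t, g t) : hprod X Y) @ G --> ((x, y) : hprod X Y).
Proof.
move=> /cvgrPdist_lt fx /cvgrPdist_lt gy; apply/cvgrPdist_lt => e e0.
have e2 : 0 < e / 2 by rewrite divr_gt0.
near=> t.
apply: le_lt_trans (hprod_norm_le _) _; rewrite (splitr e) ltrD//=; near: t.
  exact: fx.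
exact: gy.
Unshelve. all: end_near. Qed.

Lemma hprod_fst_continuous :
  continuous (fun p : hprod X Y => p.1 : X).
Proof.
move=> p; apply/(@cvgrPdist_lt _ X _ _ (nbhs_filter p)) => e e0; apply/nbhs_normP.
by exists e => //= q; exact/le_lt_trans/(le_hprod_norm1 (p - q)).
Qed.

End hprod_theory.

(** Semicontinuity and level-boundedness are stated at real levels, so a gap between extended reals
    has to be converted into a real level inside it. *)
Lemma ereal_dense {R : realFieldType} (x y : \bar R) : (x < y)%E ->
  exists a : R, (x < a%:E)%E /\ (a%:E < y)%E.
Proof.
case: x y => [x||] [y||]// xy.
- by exists ((x + y) / 2); move: xy; rewrite !lte_fin => xy; split; lra.
- by exists (x + 1); rewrite lte_fin ltry; split=> //; lra.
- by exists (y - 1); rewrite lte_fin ltNyr; split=> //; lra.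
- by exists 0; rewrite ltNyr ltry.
Qed.

(** * Existence of minimizers; properness and closedness of the inf-projection *)

Section inf_projection_theory.
Local Open Scope ereal_scope.
Context {R : realType} {X Y : finHilbertType R}.
Variable F : hprod X Y -> \bar R.

Lemma inf_projection_le x y : inf_projection F x <= F (x, y).
Proof. by apply: ereal_inf_lbound; exists y. Qed.

Lemma ArgminP x y : Argmin F x y <-> F (x, y) <= inf_projection F x.
Proof.
split=> [Fy|Fy y']; last exact: le_trans Fy (inf_projection_le x y').
by apply: le_ereal_inf_tmp => _ [y' _ <-].
Qed.

Lemma Argmin_eq x y : Argmin F x y -> F (x, y) = inf_projection F x.
Proof.
by move=> /ArgminP Fy; apply/eqP; rewrite eq_le Fy inf_projection_le.
Qed.

Context (F_closed : lower_semicontinuous F)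
  (F_level_bounded : level_bounded_locally_uniformly F).

(** The common compactness argument: a real level above [l] bounds the tail of [y], and lower
    semicontinuity controls the value at the limit. The hypothesis on [F] says that the upper limit
    of the values is at most [l], without requiring convergence. *)
Lemma level_bounded_cvg_subseq (x : nat -> X) (y : nat -> Y) (x0 : X)
    (l : \bar R) :
  x @ \oo --> x0 -> l < +oo ->
  (forall b : R, l < b%:E -> \forall n \near \oo, F (x n, y n) < b%:E) ->
  exists (phi : nat -> nat) (y0 : Y),
    [/\ forall k, (k <= phi k)%N, y (phi k) @[k --> \oo] --> y0 &
        F (x0, y0) <= l].
Proof.
move=> xx0 loo Fl.
have [b [lb _]] := ereal_dense loo.
have [V Vx0 [M [_ VM]]] := F_level_bounded x0 b.
have ybnd : \forall n \near \oo, (`|y n| <= M + 1)%R.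
  near=> n.
  apply: le_trans (le_hprod_norm2 ((x n, y n) : hprod X Y)) _.
  apply: VM; first by rewrite ltrDl.
  split; first by near: n; exact: xx0.
  by apply: ltW; near: n; exact: Fl.
have [phi [y0 [phik yy0]]] := bounded_cvg_subseq ybnd.
(* If [l < F (x0, y0)], a real [a] strictly between contradicts itself along the subsequence: the
   values are eventually below [a] by hypothesis and above [a] by semicontinuity. *)
exists phi, y0; split => //; rewrite leNgt; apply/negP => lF.
have [a [la aF]] := ereal_dense lF.
have [W W0 WF] := F_closed aF.
have phioo := cvg_subseq_infty phik.
have px : (fun k => (x (phi k), y (phi k)) : hprod X Y) @ \oo -->
    ((x0, y0) : hprod X Y).
  by apply: cvg_hprod_pair => //; exact: (cvg_comp _ _ phioo xx0).
near \oo => k.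
have : F (x (phi k), y (phi k)) < a%:E by near: k; exact: (phioo _ (Fl _ la)).
apply/negP; rewrite -leNgt; apply/ltW/WF.
by near: k; exact: px.
Unshelve. all: end_near. Qed.

(** The direct method: a minimizing sequence [y] over the constant sequence [x] has a subsequence
    converging to a minimizer. *)
Lemma Argmin_nonempty x : inf_projection F x < +oo -> exists y, Argmin F x y.
Proof.
move=> foo.
have [|u uF ul] := @ereal_inf_seq R [set F (x, y) | y in [set: Y]].
  by apply/set0P; exists (F (x, 0%R)); exists 0%R.
have [y uE] : exists y : nat -> Y, forall n, F (x, y n) = u n.
  by exists (fun n => sval (cid2 (uF n))) => n; case: cid2.
have [|phi [y0 [_ _ Fy0]]] := level_bounded_cvg_subseq (x := cst x) (y := y) (cvg_cst x) foo.
  move=> b /open_ereal_lt' /ul [N _ Nu].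
  by exists N => // n /Nu /=; rewrite uE.
by exists y0; apply/ArgminP.
Qed.

Lemma inf_projection_proper : proper_fun F -> proper_fun (inf_projection F).
Proof.
move=> [FNy [[x y] Fxy]]; split; last first.
  by exists x; exact: le_lt_trans (inf_projection_le _ _) Fxy.
(* A value other than [+oo] is attained, so it is a value of [F] and cannot be [-oo]. *)
move=> {Fxy y}x; have [->//|xoo] := eqVneq (inf_projection F x) +oo.
have [|y /Argmin_eq <-//] := @Argmin_nonempty x.
by rewrite ltey.
Qed.

Lemma inf_projection_lsc : lower_semicontinuous (inf_projection F).
Proof.
move=> x0 a af; apply: contrapT => nV.
(* If semicontinuity fails at level [a], points arbitrarily close to [x0] have values at most [a];
   attainment lifts them to points of the sublevel set of [F], whose limit contradicts
   [a < f x0]. *)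
have ex n : exists p : hprod X Y, (`|x0 - p.1| < n.+1%:R^-1)%R /\ F p <= a%:E.
  apply: contrapT => np; apply: nV.
  exists (ball x0 (n.+1%:R^-1 : R)%R).
    by apply: nbhsx_ballx; rewrite invr_gt0.
  move=> x; rewrite -ball_normE /= => xx0; rewrite ltNge; apply/negP => fa.
  have [|y xy] := @Argmin_nonempty x; first exact: le_lt_trans fa (ltry _).
  by apply: np; exists (x, y); split=> //; rewrite (Argmin_eq xy).
have [p pP] : exists p : nat -> hprod X Y,
    forall n, (`|x0 - (p n).1| < n.+1%:R^-1)%R /\ F (p n) <= a%:E.
  by exists (fun n => sval (cid (ex n))) => n; case: cid.
have px0 : (fun n => (p n).1 : X) @ \oo --> x0.
  apply/cvgrPdist_lt => e e0; near=> n; apply: lt_trans (pP n).1 _.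
  by near: n; exact: near_infty_natSinv_lt (PosNum e0).
have [|phi [y0 [_ _ Fy0]]] :=
  level_bounded_cvg_subseq (y := fun n => (p n).2) px0 (ltry a).
  move=> b ab; apply: nearW => n; rewrite -surjective_pairing.
  exact: le_lt_trans (pP n).2 ab.
by move: af; rewrite ltNge (le_trans (inf_projection_le _ _) Fy0).
Unshelve. all: end_near. Qed.

End inf_projection_theory.

(** * Regular subgradients without difference quotients *)

Section subdifferential_theory.
Context {R : realType} {H : finHilbertType R}.

Lemma dot0l (v : H) : dot 0 v = 0.
Proof.
have := dotPl (-1) 0 0 v; rewrite scaler0 addr0 mulN1r => /eqP.
by rewrite addrC subrr => /eqP.
Qed.

Lemma dot0r (v : H) : dot v 0 = 0.
Proof. by rewrite dotC dot0l. Qed.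

(** Multiplying the quotient by [|z - x|] turns the lower limit into a first-order inequality with
    error [e * |z - x|]. It is trivial at [z = x], so full neighborhoods can replace punctured
    ones. *)
Lemma regular_subdifferentialP (h : H -> \bar R) (x zeta : H) :
  h x \is a fin_num ->
  regular_subdifferential h x zeta <->
  forall e : R, 0 < e -> \forall z \near x,
    (h x + (dot zeta (z - x) - e * `|z - x|)%:E <= h z)%E.
Proof.
case hxE : (h x) => [r||]// _; rewrite /regular_subdifferential /= limf_einfE.
split=> [[_ h0] e e0|hP].
  have : ((- e)%:E < 0%:E)%E by rewrite lte_fin oppr_lt0.
  move=> /lt_le_trans /(_ h0) /ereal_sup_gt [_ [A Ax <-] Ae].
  move: Ax; rewrite /dnbhs /within /=; apply: filterS => z Az.
  have [->|zx] := eqVneq z x.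
    by rewrite subrr dot0r normr0 mulr0 subr0 adde0 hxE.
  have n0 : 0 < `|z - x| by rewrite normr_gt0 subr_eq0.
  have : ((- e)%:E < (h z - h x - (dot zeta (z - x))%:E) * (`|z - x|^-1)%:E)%E.
    by apply: lt_le_trans Ae _; apply: ereal_inf_lbound; exists z => //; exact: Az.
  rewrite hxE; case: (h z) => [s||].
  - rewrite -!EFinB -EFinM -EFinD lte_fin lee_fin ltr_pdivlMr// => ?; lra.
  - by rewrite leey.
  - by rewrite !addNye mulNyr gtr0_sg ?invr_gt0// mul1e ltNge leNye.
split; first by rewrite hxE ltry.
apply/lee_subgt0Pr => e e0; rewrite sub0e.
(* The points [z != x] satisfying the inequality for [e] form a punctured neighborhood; the infimum
   of the quotient over it is one of the terms of the supremum defining the lower limit. *)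
apply: (@le_trans _ _ (ereal_inf
  [set ((h z - h x - (dot zeta (z - x))%:E) * (`|z - x|^-1)%:E)%E | z in
   [set z | z != x /\
     (h x + (dot zeta (z - x) - e * `|z - x|)%:E <= h z)%E]])); last first.
  apply: ereal_sup_ubound; eexists; last reflexivity.
  rewrite /dnbhs /within /=; have := hP _ e0; apply: filterS => z hz zx.
  by split => //; rewrite hxE.
apply: le_ereal_inf_tmp => _ [z [zx hz] <-]; move: hz; rewrite hxE.
have n0 : 0 < `|z - x| by rewrite normr_gt0 subr_eq0.
case: (h z) => [s||].
- by rewrite -!EFinB -EFinM -EFinD -EFinN !lee_fin ler_pdivlMr// => ?; lra.
- by rewrite !addye// mulyr gtr0_sg ?invr_gt0// mul1e !leey.
- by rewrite leeNy_eq.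
Qed.

End subdifferential_theory.

(** * The KL inequality in real terms *)

Section KL_inequality.
Context {R : realType}.

(** For empty [D] both sides hold, the distance being [+oo] and [k] positive. *)
Lemma dist_set0_ge1P {H : finHilbertType R} (D : set H) (k : R) : 0 < k ->
  (1 <= k%:E * dist_set 0%R D)%E <-> forall zeta, D zeta -> 1 <= k * `|zeta|.
Proof.
move=> k0; rewrite -lee_pdivrMl// mule1; split=> [kD zeta Dz|kD].
  rewrite mulrC -ler_pdivrMr// mul1r -lee_fin; apply: le_trans kD _.
  by apply: ereal_inf_lbound; exists zeta; rewrite ?sub0r ?normrN.
apply: le_ereal_inf_tmp => _ [zeta Dz <-].
by rewrite lee_fin sub0r normrN -[leLHS]mulr1 ler_pdivrMl//; exact: kD.
Qed.

Lemma derive1_scale_powR (c b s : R) : 0 < s ->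
  derive1 (fun t => c * t `^ b) s = c * (b * s `^ (b - 1)).
Proof.
move=> s0; rewrite derive1E.
have ds := is_derive1_powR b s0.
by rewrite deriveZ//= derive_val.
Qed.

End KL_inequality.

(** * Lifting subgradients of the inf-projection to [F] *)

Section inf_projection_subdifferential.
Context {R : realType} {X Y : finHilbertType R}.
Context (F : hprod X Y -> \bar R) (F_proper : proper_fun F)
  (F_closed : lower_semicontinuous F)
  (F_level_bounded : level_bounded_locally_uniformly F).

Lemma inf_projection_fin_num x :
  (inf_projection F x < +oo)%E -> inf_projection F x \is a fin_num.
Proof.
by move=> foo; rewrite fin_numE (proj1 (inf_projection_proper _ _ _))//= -ltey.
Qed.

Lemma regular_subdifferential_inf_projection x y zeta : Argmin F x y ->
  regular_subdifferential (inf_projection F) x zeta ->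
  regular_subdifferential F (x, y) (zeta, 0).
Proof.
move=> xy rf; have ffin := inf_projection_fin_num rf.1.
have FE := Argmin_eq xy.
apply/regular_subdifferentialP; first by rewrite FE.
move=> e e0; have /regular_subdifferentialP/(_ e e0) := rf => /(_ ffin) fx.
have : \forall q \near ((x, y) : hprod X Y),
    (inf_projection F x + (dot zeta (q.1 - x) - e * `|q.1 - x|)%:E
      <= inf_projection F q.1)%E.
  exact: (@hprod_fst_continuous R X Y (x, y) _ fx).
apply: filterS => q fq; rewrite FE [q in leRHS]surjective_pairing.
apply: le_trans (inf_projection_le _ _ _); apply: le_trans fq.
(* Pairing with [(zeta, 0)] only sees the first component, and enlarging [|q.1 - x|] to the norm of
   [q - (x, y)] weakens the inequality. *)
rewrite leeD2l// lee_fin [dot _ _]/(hprod_dot _ _) /hprod_dot /= dot0l addr0.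
by rewrite lerD2l lerN2 ler_pM2l// (le_hprod_norm1 (q - (x, y))).
Qed.

Lemma subdifferential_inf_projection x zeta :
  subdifferential (inf_projection F) x zeta ->
  exists2 y, Argmin F x y & subdifferential F (x, y) (zeta, 0).
Proof.
move=> [foo [u [v [ux fu vz rfu]]]].
have ex k := Argmin_nonempty F_closed F_level_bounded (rfu k).1.
pose y k := sval (cid (ex k)).
have yP k : Argmin F (u k) (y k) by rewrite /y; case: cid.
(* Since [F (u k, y k)] equals [f (u k)], the convergence of values required of a limiting
   subgradient passes from [f] to [F]. *)
have [|phi [y0 [phik yy0 Fy0]]] :=
    level_bounded_cvg_subseq F_closed F_level_bounded (y := y) ux foo.
  move=> b /open_ereal_lt' /fu [N _ Nu].
  by exists N => // k /Nu /=; rewrite (Argmin_eq (yP k)).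
have phioo := cvg_subseq_infty phik.
have xy0 : Argmin F x y0 by apply/ArgminP.
exists y0 => //; split; first by rewrite (Argmin_eq xy0).
exists (fun k => (u (phi k), y (phi k))), (fun k => (v (phi k), 0)); split.
- by apply: cvg_hprod_pair => //; exact: (cvg_comp _ _ phioo ux).
- rewrite (Argmin_eq xy0).
  under eq_fun do rewrite (Argmin_eq (yP _)).
  exact: (cvg_comp _ _ phioo fu).
- by apply: cvg_hprod_pair; [exact: (cvg_comp _ _ phioo vz)|exact: cvg_cst].
- by move=> k; exact: regular_subdifferential_inf_projection.
Qed.

End inf_projection_subdifferential.

(** * Transfer of the KL property *)

Unset Implicit Arguments.

Theorem theorem3p1 (R : realType) (X Y : finHilbertType R)
    (F : hprod X Y -> \bar R) (alpha : R) (xbar : X)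
    (F_proper : proper_fun F)
    (F_closed : lower_semicontinuous F)
    (F_level_bounded : level_bounded_locally_uniformly F)
    (alpha_ge0 : 0 <= alpha) (alpha_lt1 : alpha < 1)
    (xbar_dom : dom_subdifferential (inf_projection F) xbar)
    (F_subdiff : forall ybar : Y, Argmin F xbar ybar ->
       subdifferential F (xbar, ybar) !=set0)
    (F_KL : forall ybar : Y, Argmin F xbar ybar ->
       KL_property F alpha (xbar, ybar)) :
  KL_property (inf_projection F) alpha xbar.
Proof.
have f_proper := inf_projection_proper F_closed F_level_bounded F_proper.
split => //; first exact: inf_projection_lsc.
have [_ [fbar_oo _]] := xbar_dom.
have fbar := inf_projection_fin_num F_proper F_closed F_level_bounded fbar_oo.
pose f := inf_projection F.
(* For [s > 0], [G s] is the derivative of the power with exponent [1 - alpha]. Factoring out the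
   constant reduces the final contradiction to comparing [c] with [(phi k).+1]. *)
pose G (s : R) := (1 - alpha) * s `^ (1 - alpha - 1).
have G0 s : 0 < s -> 0 < G s.
  by move=> s0; rewrite mulr_gt0 ?subr_gt0// powR_gt0.
have gap0 x : (f xbar < f x)%E -> (f x < +oo)%E -> 0 < fine (f x - f xbar)%E.
  move=> fx foo; have ffin := inf_projection_fin_num F_proper F_closed F_level_bounded foo.
  by rewrite -lte_fin fineK ?fin_numB ?ffin// sube_gt0.
apply: contrapT => noKL.
(* Failure of the KL property is used with width and radius [1 / (n + 1)] and constant [n + 1]; each
   violating subgradient is lifted to [F] at once. *)
have ex n : exists xyz : X * Y * X, let: (x, y, zeta) := xyz in
    [/\ `|xbar - x| < n.+1%:R^-1,
        (f xbar < f x < f xbar + (n.+1%:R^-1)%:E)%E,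
        Argmin F x y /\ subdifferential F (x, y) (zeta, 0) &
        n.+1%:R * G (fine (f x - f xbar)%E) * `|zeta| < 1].
  apply: contrapT => nx; apply: noKL.
  exists (n.+1%:R^-1)%:E, (ball xbar (n.+1%:R^-1 : R)), n.+1%:R.
  split => //.
    by apply: nbhsx_ballx; rewrite invr_gt0.
  move=> phi x; rewrite -ball_normE /= => xn f_lt f_gt.
  have gap := gap0 _ f_lt (lt_le_trans f_gt (leey _)).
  rewrite derive1_scale_powR//; apply/dist_set0_ge1P.
    by rewrite mulr_gt0//; exact: G0.
  move=> zeta fzeta; rewrite leNgt; apply/negP => z1; apply: nx.
  have [y xy Fzeta] :=
    subdifferential_inf_projection F_proper F_closed F_level_bounded fzeta.
  by exists (x, y, zeta); split => //; apply/andP; split.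
have [xyz xyzP] := choice ex.
pose x n : X := (xyz n).1.1; pose y n : Y := (xyz n).1.2.
pose zeta n : X := (xyz n).2.
have {xyzP} xyzP n :
    [/\ `|xbar - x n| < n.+1%:R^-1,
        (f xbar < f (x n) < f xbar + (n.+1%:R^-1)%:E)%E,
        Argmin F (x n) (y n) /\ subdifferential F (x n, y n) (zeta n, 0) &
        n.+1%:R * G (fine (f (x n) - f xbar)%E) * `|zeta n| < 1].
  by have := xyzP n; rewrite /x /y /zeta; case: (xyz n) => -[].
have xx : x @ \oo --> xbar.
  apply/cvgrPdist_lt => e e0; near=> n; have [xn _ _ _] := xyzP n.
  by apply: lt_trans xn _; near: n; exact: near_infty_natSinv_lt (PosNum e0).
have f_lt (b : \bar R) : (f xbar < b)%E -> \forall n \near \oo, (f (x n) < b)%E.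
  case: b => [b||] fb; last by rewrite ltNge leNye in fb.
  - have d0 : 0 < b - fine (f xbar).
      by rewrite subr_gt0 -lte_fin fineK.
    near=> n; have [_ /andP[_ fn] _ _] := xyzP n; apply: lt_trans fn _.
    rewrite /f -(fineK fbar) -EFinD lte_fin -ltrBrDl.
    by near: n; exact: near_infty_natSinv_lt (PosNum d0).
  - apply: nearW => n; have [_ /andP[_ fn] _ _] := xyzP n.
    exact: lt_le_trans fn (leey _).
have FE n : F (x n, y n) = f (x n).
  by have [_ _ [/Argmin_eq]] := xyzP n.
have [|phi [ybar [phik yybar Fybar]]] :=
    level_bounded_cvg_subseq F_closed F_level_bounded (y := y) xx fbar_oo.
  by move=> b /f_lt; apply: filterS => n; rewrite FE.
have phioo := cvg_subseq_infty phik.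
have xybar : Argmin F xbar ybar by apply/ArgminP.
have [_ _ _ [a [V [c [a0 V0 c0 /= KL]]]]] := F_KL _ xybar.
have xycvg : (fun k => (x (phi k), y (phi k)) : hprod X Y) @ \oo -->
    ((xbar, ybar) : hprod X Y).
  by apply: cvg_hprod_pair => //; exact: (cvg_comp _ _ phioo xx).
have f_lt_a : \forall k \near \oo, (f (x (phi k)) < f xbar + a)%E.
  by apply: (phioo _ (f_lt _ _)); rewrite lteDl.
near \oo => k.
have [_ /andP[f_gt f_foo] [_ Fzeta] small] := xyzP (phi k).
have gap := gap0 _ f_gt (lt_le_trans f_foo (leey _)).
move: small; apply/negP; rewrite -leNgt.
have Vk : V (x (phi k), y (phi k)) by near: k; exact: xycvg.
have fk : (f (x (phi k)) < f xbar + a)%E by near: k; exact: f_lt_a.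
(* The constant of the violated inequality eventually exceeds the KL constant [c] of [F], so the two
   inequalities are incompatible. *)
have ck : c <= (phi k).+1%:R.
  apply: (@le_trans _ _ k%:R); first by near: k; exact: nbhs_infty_ger.
  by rewrite ler_nat leqW.
have := KL _ Vk; rewrite FE (Argmin_eq xybar) => /(_ f_gt fk).
rewrite derive1_scale_powR// => /dist_set0_ge1P.
rewrite mulr_gt0// ?G0// => /(_ isT _ Fzeta); rewrite hprod_norm_pair0.
by move=> /le_trans; apply; rewrite !ler_wpM2r// ltW// G0.
Unshelve. all: end_near. Qed.
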